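(* For $k\ge 0$ let $b^+_k$ denote the number of elements of length $k$ in $\mathcal{MB}^+_3$. Then $$\sum_{k\ge 0} b^+_k t^k = 1+2t+4t^2+6t^3+10t^4+16t^5+\cdots,$$ where $b^+_k=2F_{k+1}$ for all $k\ge 1$.
   Context: $(F_n)_{n\ge 0}$ is the Fibonacci sequence $F_0=0$, $F_1=1$, $F_{n+1}=F_n+F_{n-1}$. The monoid of positive $n$-braids $\mathcal{MB}_n$ is the monoid with generators $x_1,\dots,x_{n-1}$ and relations $x_ix_j=x_jx_i$ for $|i-j|\ge 2$ and $x_ix_{i+1}x_i=x_{i+1}x_ix_{i+1}$ for $1\le i\le n-2$; word length is well defined on it. The Garside braid is $\Delta_n=x_1(x_2x_1)\cdots(x_{n-1}x_{n-2}\cdots x_1)$ (so $\Delta_3=x_1x_2x_1$). $\mathcal{MB}^+_n$ is the set of positive $n$-braids that do not contain $\Delta_n$ as a subword, i.e. positive braids $\beta$ which cannot be written as $\beta=\alpha\Delta_n\gamma$ with $\alpha,\gamma\in\mathcal{MB}_n$. *)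

(* Defs.v *)
From HB Require Import structures.
From mathcomp Require Import all_boot generic_quotient finmap.
From mathcomp Require Import boolp classical_sets functions cardinality.

Set Implicit Arguments.
Unset Strict Implicit.
Unset Printing Implicit Defensive.

Local Open Scope quotient_scope.
Local Open Scope classical_set_scope.

Fixpoint fib (n : nat) : nat :=
  if n is n1.+1 then (if n1 is n2.+1 then fib n1 + fib n2 else 1) else 0.

(* Words in x_1, ..., x_(n-1); the generator x_i is encoded by the ordinal of
   value i - 1. *)
Definition braid_word (n : nat) := seq 'I_n.-1.

Inductive braid_rel (n : nat) : braid_word n -> braid_word n -> Prop :=
| braid_rel_comm (i j : 'I_n.-1) :
    (i.+2 <= j) || (j.+2 <= i) -> braid_rel [:: i; j] [:: j; i]
| braid_rel_braid (i j : 'I_n.-1) :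
    j = i.+1 :> nat -> braid_rel [:: i; j; i] [:: j; i; j].

Inductive braid_cong (n : nat) : braid_word n -> braid_word n -> Prop :=
| braid_cong_rel u v : braid_rel u v -> braid_cong u v
| braid_cong_refl u : braid_cong u u
| braid_cong_sym u v : braid_cong u v -> braid_cong v u
| braid_cong_trans u v w : braid_cong u v -> braid_cong v w -> braid_cong u w
| braid_cong_cat u u' v v' :
    braid_cong u u' -> braid_cong v v' -> braid_cong (u ++ v) (u' ++ v').

Definition braid_congb (n : nat) : rel (braid_word n) :=
  fun u v => `[< braid_cong u v >].

Lemma braid_congb_equiv n : equiv_class_of (@braid_congb n).
Proof.
split=> [u|u v|v u w].
- by apply/asboolP; apply: braid_cong_refl.
- by apply/asboolP/asboolP; apply: braid_cong_sym.
- by move=> /asboolP uv /asboolP vw; apply/asboolP; apply: braid_cong_trans vw.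
Qed.

Canonical braid_equiv n := EquivRelPack (braid_congb_equiv n).

Definition MB (n : nat) := {eq_quot (braid_equiv n)}.
HB.instance Definition _ n := Choice.on (MB n).
HB.instance Definition _ n := Quotient.on (MB n).

Definition braid_of (n : nat) (w : braid_word n) : MB n := \pi_(MB n) w.

Lemma braid_ofP n (u v : braid_word n) :
  braid_of u = braid_of v <-> braid_cong u v.
Proof.
split=> [/eqquotP/asboolP //|uv].
by apply/eqquotP; apply/asboolP.
Qed.

Lemma repr_braid_of n (w : braid_word n) : braid_cong (repr (braid_of w)) w.
Proof. by apply/braid_ofP; rewrite /braid_of reprK. Qed.

Definition MB_mul (n : nat) (a b : MB n) : MB n := braid_of (repr a ++ repr b).
Definition MB_one (n : nat) : MB n := braid_of [::].

Lemma braid_of_cat n (u v : braid_word n) :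
  MB_mul (braid_of u) (braid_of v) = braid_of (u ++ v).
Proof. by apply/braid_ofP/braid_cong_cat; apply: repr_braid_of. Qed.

Lemma braid_of_repr n (a : MB n) : braid_of (repr a) = a.
Proof. exact: reprK. Qed.

Lemma MB_mulA n : associative (@MB_mul n).
Proof.
move=> a b c; rewrite -(braid_of_repr a) -(braid_of_repr b) -(braid_of_repr c).
by rewrite !braid_of_cat catA.
Qed.

Lemma MB_mul1 n : left_id (@MB_one n) (@MB_mul n).
Proof. by move=> a; rewrite -(braid_of_repr a) braid_of_cat. Qed.

Lemma MB_mulr1 n : right_id (@MB_one n) (@MB_mul n).
Proof. by move=> a; rewrite -(braid_of_repr a) braid_of_cat cats0. Qed.

HB.instance Definition _ n :=
  isMonoid.Build (MB n) (@MB_mulA n) (@MB_mul1 n) (@MB_mulr1 n).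

Definition MB_length (n : nat) (a : MB n) : nat := size (repr a).

Lemma braid_cong_size n (u v : braid_word n) :
  braid_cong u v -> size u = size v.
Proof.
elim=> {u v} //= [u v []//|u v w _ -> _ -> //|u u' v v' _ e1 _ e2].
by rewrite !size_cat e1 e2.
Qed.

Lemma MB_length_braid_of n (w : braid_word n) : MB_length (braid_of w) = size w.
Proof. exact/braid_cong_size/repr_braid_of. Qed.

(* x_1 (x_2 x_1) ... (x_(n-1) ... x_1) *)
Definition Garside_word (n : nat) : braid_word n :=
  flatten [seq rev (take i (enum 'I_n.-1)) | i <- iota 1 n.-1].

Definition Garside (n : nat) : MB n := braid_of (Garside_word n).

Lemma Garside_word3 : Garside_word 3 = [:: ord0; ord_max; ord0].
Proof.
have e : enum 'I_2 = [:: ord0; ord_max].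
  by apply: (inj_map val_inj); rewrite val_enum_ord.
by rewrite /Garside_word [3.-1]/= e.
Qed.

Definition MBplus (n : nat) : set (MB n) :=
  [set b | ~ exists a c : MB n, b = (a * Garside n * c)%g].

Definition MBplus_len (n k : nat) : set (MB n) :=
  [set b | MBplus b /\ MB_length b = k].

Lemma finite_MBplus_len n k : finite_set (@MBplus_len n k).
Proof.
apply: (@sub_finite_set _ _
  ((fun t : k.-tuple 'I_n.-1 => braid_of (val t)) @` setT)).
  move=> b [_ /eqP bk]; exists (Tuple bk) => //=.
  exact: braid_of_repr.
exact/finite_image/finite_finset.
Qed.

Definition bplus (n k : nat) : nat := #|` fset_set (@MBplus_len n k)|.

(* Main.v *)
Require Import Defs.
From mathcomp Require Import all_boot.
From mathcomp Require Import finmap boolp cardinality monoid.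

(** In three strands the only relation is [aba = bab], with [aba] the Garside
    word.  A word without a factor [aba] or [bab] is therefore alone in its
    congruence class, while a word with such a factor represents a braid
    divisible by the Garside braid.  So the braids to be counted are the words
    avoiding [aba] and [bab].  Such a word starting with [x] continues either
    with [x] again, or as [x y] followed by a word starting with [y] (or empty),
    which gives the Fibonacci recurrence. *)

Set Implicit Arguments.
Unset Strict Implicit.
Unset Printing Implicit Defensive.

Section AlternatingFactor.
Variable T : eqType.
Implicit Types (x y : T) (s u v : seq T).

Fixpoint has_alt s : bool :=
  if s is x :: s' then
    (if s' is y :: z :: _ then (x == z) && (x != y) else false) || has_alt s'
  else false.

Lemma has_alt_catr u v : has_alt v -> has_alt (u ++ v).
Proof. by elim: u => //= x u IH /IH ->; rewrite orbT. Qed.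

Lemma has_alt_catl u v : has_alt u -> has_alt (u ++ v).
Proof.
elim: u => //= x u IH /orP[|/IH ->]; last by rewrite orbT.
by case: u {IH} => [|y [|z u]] //= ->.
Qed.

Lemma has_altP s :
  has_alt s -> exists x y p q, x != y /\ s = p ++ [:: x; y; x] ++ q.
Proof.
elim: s => // x s IH /= /orP[|/IH].
  case: s {IH} => [|y [|z s]] //= /andP[/eqP <- xy].
  by exists x, y, [::], s.
by move=> [y [z [p [q [yz ->]]]]]; exists y, z, (x :: p), q.
Qed.

End AlternatingFactor.

(** On two letters [rev_ord] is the exchange, so it serves below as a name for the other letter. *)
Lemma ord2_neq (x y : 'I_2) : x != y -> y = rev_ord x.
Proof.
by case: x => [[|[|x]] hx] //; case: y => [[|[|y]] hy] // _; apply/val_inj.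
Qed.

Lemma rev_ord2_neq (x : 'I_2) : (x == rev_ord x) = false.
Proof. by case: x => [[|[|x]] hx]. Qed.

Lemma braid3_cong_alt (x y : 'I_2) :
  x != y -> @braid_cong 3 [:: x; y; x] (Garside_word 3).
Proof.
move=> /ord2_neq ->; rewrite Garside_word3.
(* For [x] of value 0 the word is the Garside word itself; for value 1 it is the other side of the
   braid relation. *)
case: x => [[|[|x]] hx] //.
  suff -> : [:: Ordinal hx; rev_ord (Ordinal hx); Ordinal hx]
    = [:: ord0; ord_max; ord0] by apply: braid_cong_refl.
  by congr [:: _; _; _]; apply/val_inj.
suff -> : [:: Ordinal hx; rev_ord (Ordinal hx); Ordinal hx]
  = [:: ord_max; ord0; ord_max].
  by apply/braid_cong_sym/braid_cong_rel/braid_rel_braid.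
by congr [:: _; _; _]; apply/val_inj.
Qed.

(** Both sides of the braid relation contain an alternating factor, and the disjunction is stable
    under symmetry, transitivity and concatenation. Hence [has_alt] is invariant under congruence,
    and its negation forces a singleton class. *)
Lemma braid3_cong_eq_or_alt (u v : braid_word 3) :
  braid_cong u v -> u = v \/ has_alt u /\ has_alt v.
Proof.
elim=> {u v} [u v []|u|u v _|u v w _ IH1 _ IH2|u u' v v' _ IH1 _ IH2].
(* Commutation is vacuous: the indices of two generators differ by at most 1. *)
- by move=> [[|[|i]] hi] [[|[|j]] hj].
- move=> i j ij; right.
  have ne : i != j by apply/eqP => eij; move: ij; rewrite eij => /n_Sn.
  by rewrite /= !eqxx ne eq_sym ne.
- by left.
- by case=> [->|[]]; [left|right].
- case: IH1 => [->//|[hu hv]]; right; split=> //.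
  by case: IH2 => [<-//|[]].
- case: IH1 => [<-|[hu hu']]; last by right; split; apply: has_alt_catl.
  case: IH2 => [<-|[hv hv']]; first by left.
  by right; split; apply: has_alt_catr.
Qed.

Lemma mul_Garside n (p q : braid_word n) :
  (braid_of p * Garside n * braid_of q)%g = braid_of (p ++ Garside_word n ++ q).
Proof.
by rewrite -[(braid_of p * _)%g]/(MB_mul _ (braid_of _)) braid_of_cat
  -[(_ * _)%g]/(MB_mul _ _) braid_of_cat catA.
Qed.

Lemma MBplus3P (w : braid_word 3) : MBplus (braid_of w) <-> ~~ has_alt w.
Proof.
split=> [hb|hw [a [c]]].
  apply/negP => /has_altP[x [y [p [q [xy e]]]]]; apply: hb.
  exists (braid_of p), (braid_of q); rewrite mul_Garside e; apply/braid_ofP.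
  apply: braid_cong_cat; first exact: braid_cong_refl.
  by apply: braid_cong_cat; [apply: braid3_cong_alt|apply: braid_cong_refl].
rewrite -(braid_of_repr a) -(braid_of_repr c) mul_Garside.
move=> /braid_ofP /braid3_cong_eq_or_alt[e|[hw' _]]; last by rewrite hw' in hw.
by move: hw; rewrite e has_alt_catr // has_alt_catl // Garside_word3.
Qed.

(** Since [braid_of] is injective on words without an alternating factor, counting braids reduces to
    listing such words without repetition. *)
Lemma bplus3_size k (L : seq (braid_word 3)) :
    uniq L -> (forall w, (w \in L) = (size w == k) && ~~ has_alt w) ->
  bplus 3 k = size L.
Proof.
move=> uL memL; rewrite /bplus.
have injL : {in L &, injective (@braid_of 3)}.
  move=> u v; rewrite memL => /andP[_ hu] _.
  by move=> /braid_ofP /braid3_cong_eq_or_alt[|[hu' _]] //; rewrite hu' in hu.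
have -> : fset_set (@MBplus_len 3 k) = [fset b in map (@braid_of 3) L]%fset.
  apply/fsetP => b; rewrite in_fset_set; last exact: finite_MBplus_len.
  rewrite !inE; apply/asboolP/mapP => [[hb hk]|[w]].
    exists (generic_quotient.repr b); last by rewrite braid_of_repr.
    rewrite memL -[size _]/(MB_length b) hk eqxx.
    by apply/MBplus3P; rewrite braid_of_repr.
  rewrite memL => /andP[/eqP hk hw] ->; split; first exact/MBplus3P.
  by rewrite MB_length_braid_of.
by rewrite card_fseq undup_id ?size_map // map_inj_in_uniq.
Qed.

(* For [k = 0] the empty word counts as starting with [x]; this makes the
   recurrence start at [fib 1] and [fib 2]. *)
Fixpoint alt_free_from (k : nat) (x : 'I_2) : seq (seq 'I_2) :=
  if k is k1.+1 then
    if k1 is k2.+1 then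
      [seq x :: w | w <- alt_free_from k1 x] ++
      [seq [:: x, rev_ord x & w] | w <- alt_free_from k2 (rev_ord x)]
    else [:: [:: x]]
  else [:: [::]].

Lemma alt_free_from_recur k x : alt_free_from k.+2 x =
  [seq x :: w | w <- alt_free_from k.+1 x] ++
  [seq [:: x, rev_ord x & w] | w <- alt_free_from k (rev_ord x)].
Proof. by []. Qed.

Lemma pair_nat_ind (P : nat -> Prop) :
  P 0 -> P 1 -> (forall k, P k -> P k.+1 -> P k.+2) -> forall k, P k.
Proof.
move=> P0 P1 PS k; suff [] : P k /\ P k.+1 by [].
by elim: k => [|k [Pk PSk]]; split=> //; apply: PS.
Qed.

Lemma size_alt_free_from k x : size (alt_free_from k x) = fib k.+1.
Proof.
elim/pair_nat_ind: k x => // k IH IH1 x.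
by rewrite alt_free_from_recur size_cat !size_map IH IH1.
Qed.

(** The default [x] in [head x w] lets the empty word count as starting with [x], as in the
    definition. *)
Lemma mem_alt_free_from k x w :
  (w \in alt_free_from k x) = [&& size w == k, ~~ has_alt w & head x w == x].
Proof.
elim/pair_nat_ind: k x w => [x [|y w]|x [|y [|z w]]|k IH IH1 x w] //.
- by rewrite /= eqxx.
- by rewrite /= inE eqseq_cons eqxx andbT.
- by rewrite /= inE eqseq_cons andbF.
rewrite alt_free_from_recur mem_cat.
have inj1 : injective (cons x) by move=> u v [].
(* A word not of this form is too short or has the wrong first letter, so both sides are false. *)
have [[y [v ->]]|wx] := pselect (exists y v, w = [:: x, y & v]); last first.
  rewrite (_ : _ && _ = false); last first.
    case: w wx => [|z [|y v]] //= wx; apply/and3P => -[_ _ /eqP zx].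
    by apply: wx; exists y, v; rewrite zx.
  apply/negbTE; rewrite negb_or; apply/andP; split; apply/mapP => -[u].
    rewrite IH1 => /and3P[/eqP]; case: u => // y u _ _ _ e.
    by apply: wx; exists y, u.
  by move=> _ e; apply: wx; exists (rev_ord x), u.
rewrite mem_map // IH1 /= !eqSS eqxx andbT.
(* The second letter decides which of the two lists can contain the word. A prefix [x x] starts no
   alternating factor, so only the tail matters. *)
have [->|/[dup] xy /ord2_neq ->] := eqVneq y x.
  rewrite (_ : (_ \in map _ _) = false) ?orbF; last first.
    by apply/mapP => -[u _ [/eqP]]; rewrite rev_ord2_neq.
  by rewrite andbT; case: v => [|z v]; rewrite ?andbF.
rewrite !andbF /= rev_ordK mem_map => [|u v' []//]; rewrite IH.
case: v => [|z v] /=; first by rewrite eqxx.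
(* After [x y], a third letter [y] creates no alternating factor at the front, while the other
   choice is [x] and produces [x y x]. *)
have [->|/[dup] zy /ord2_neq yE] := eqVneq z y.
  rewrite [rev_ord y == y]eq_sym rev_ord2_neq !andbT /=.
  by case: v => [|t v] //; rewrite andbF.
by rewrite yE rev_ordK eqxx !andbF.
Qed.

Lemma uniq_alt_free_from k x : uniq (alt_free_from k x).
Proof.
elim/pair_nat_ind: k x => // k IH IH1 x.
rewrite alt_free_from_recur cat_uniq.
rewrite !map_inj_uniq ?IH ?IH1 => [|u v []|u v []] //.
(* The two lists are disjoint because the second letter is [x] in the first and [rev_ord x] in the
   second. *)
rewrite andbT; apply/hasPn => _ /mapP[w _ ->]; apply/mapP => -[u].
rewrite mem_alt_free_from => /and3P[_ _ /[swap]] -[<-] /=.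
by rewrite eq_sym rev_ord2_neq.
Qed.

Lemma bplus3_0 : bplus 3 0 = 1.
Proof. by rewrite (@bplus3_size 0 [:: [::]]) // => -[|x w]. Qed.

(** The factor 2 is the choice of the first letter. Positive length is essential: at length 0 both
    lists would hold the same empty word. *)
Lemma bplus3_pos k : bplus 3 k.+1 = 2 * fib k.+2.
Proof.
rewrite (@bplus3_size k.+1
  (alt_free_from k.+1 ord0 ++ alt_free_from k.+1 ord_max)).
- by rewrite size_cat !size_alt_free_from mul2n addnn.
- rewrite cat_uniq !uniq_alt_free_from andbT; apply/hasPn => w.
  rewrite !mem_alt_free_from; case: w => [|x w] //= /and3P[_ _ /eqP ->].
  by rewrite !andbF.
- move=> w; rewrite mem_cat !mem_alt_free_from.
  case: w => [|x w] //; rewrite !andbA -andb_orr [X in _ && X](_ : _ = true).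
    by rewrite andbT.
  by case: x => [[|[|x]] hx].
Qed.

Theorem theorem1p3 :
  [seq bplus 3 k | k <- iota 0 6] = [:: 1; 2; 4; 6; 10; 16] /\
  (forall k : nat, 1 <= k -> bplus 3 k = 2 * fib k.+1).
Proof.
split=> [|[|k] // _]; last exact: bplus3_pos.
by rewrite /= bplus3_0 !bplus3_pos.
Qed.
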